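(* Consider the mean-error model of the U-sup network without transfer of coefficients ($L\to\infty$), namely the recursion $$\overline\Theta_i=\begin{bmatrix}(I_{MN}-\overline{\mathcal L}_i)\,G & \overline{\mathcal L}_i\\ 0& I_{MN}-R_\mu\end{bmatrix}\overline\Theta_{i-1},\qquad \overline\Theta_i\in\mathbb R^{2MN},$$ with $G$, $\overline{\mathcal L}_i$, $R_\mu$ as defined in the context. If the step-sizes $\mu_n$ are chosen so that all node filters are stable in the mean, i.e. $\rho(I_{MN}-R_\mu)<1$ (where $\rho$ is the spectral radius), then $\overline\Theta_i$ converges to the origin exponentially fast; that is, the scheme converges in the mean.
   Context: There are $N$ nodes, each running a local adaptive filter of order $M$ (LMS or NLMS) with step-size $\mu_n$. The regressors $u_{n,i}\in\mathbb R^{1\times M}$ at node $n$ are zero-mean i.i.d. with covariance matrix $R_n$. Let $w_i^o$ be the vector to be estimated, $\psi_{n,i}$ the local filter estimate and $w_{n,i}$ the supervisor output at node $n$, which combines $\psi_{n,i-1}$ with weight $\lambda_n(i)=1/(1+e^{-a_n(i-1)})$ and the neighborhood average $\sum_\ell c_{n,\ell}w_{\ell,i-1}$ with weight $1-\lambda_n(i)$. The vector $\overline\Theta_i$ models the mean of the stacked error vector $\mathrm{col}(\widetilde w_i,\widetilde\psi_i)$, where $\widetilde w_i=\mathrm{col}(w_i^o-w_{n,i})_{n=1}^N$ and $\widetilde\psi_i=\mathrm{col}(w_i^o-\psi_{n,i})_{n=1}^N$. Notation: $C=[c_{n,\ell}]$ is the $N\times N$ combiner matrix, with $c_{n,\ell}\ge0$,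 $c_{n,\ell}=0$ unless $\ell\ne n$ is linked to $n$, and $\sum_{\ell=1}^Nc_{n,\ell}=1$ for every $n$; $G=C\otimes I_M$ (Kronecker product). $\overline{\mathcal L}_i=\overline\Lambda_i\otimes I_M$ with $\overline\Lambda_i=\mathrm{diag}(\overline\lambda_1(i),\dots,\overline\lambda_N(i))$ and $\overline\lambda_n(i)=\frac{1}{1+e^{-\overline a_n(i-1)}}$, where $\overline a_n(i)$ is the mean of the supervisor variable $a_n(i)$, which the algorithm truncates to $[-a_+,a_+]$ for a fixed $a_+>0$; thus $\overline\lambda_n(i)\in\left[\frac1{1+e^{a_+}},\frac1{1+e^{-a_+}}\right]$ for all $n,i$ (the values $\overline\lambda_n(i)$ may depend on the second-order statistics, hence on $\overline\Theta$, so the recursion need not be linear). $R_\mu$ is the block-diagonal matrix $R_\mu=\mathrm{diag}(\mu_nR_n)$ if the nodes use LMS, and $R_\mu=\mathrm{diag}\left(\frac{\mu_n}{M\sigma_{u,n}^2}R_n\right)$ if they use NLMS with tap-delay-line regressors, where $\sigma_{u,n}^2=E\{u_n^2(i)\}$ is the variance of the scalar input at node $n$. *)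

(* Defs.v *)
From mathcomp Require Export all_boot all_order all_algebra.
From mathcomp Require Export all_classical all_reals all_analysis.
From mathcomp Require Export complex mxtens.

Set Implicit Arguments.
Unset Strict Implicit.
Unset Printing Implicit Defensive.

Import Order.TTheory GRing.Theory Num.Theory.
Import numFieldNormedType.Exports.

Local Open Scope classical_set_scope.
Local Open Scope ring_scope.

(* Complex eigenvalues of a real matrix.  [eigenvalue] is about row
   eigenvectors; left and right spectra coincide.  The set below is finite. *)
Definition spectral_radius (R : realType) (n : nat) (A : 'M[R]_n) : R :=
  sup [set complex.Re `|z| |
       z in [set z : R[i] | eigenvalue (map_mx (real_complex R) A) z]].

(* diag(B_1, ..., B_N) = \sum_n E_nn (x) B_n, with the index convention of the
   Kronecker product [*t]: block number first, position in the block second. *)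
Definition blockdiag (R : realType) (N M : nat) (B : 'I_N -> 'M[R]_M) :
    'M[R]_(N * M) :=
  \sum_(n < N) delta_mx n n *t B n.

Section RandomVectors.
Context {d d' : measure_display} {T : measurableType d} {T' : measurableType d'}.
Context {R : realType} (P : probability T R).

Definition identically_distributed (X : nat -> {RV P >-> T'}) : Prop :=
  forall (i : nat) (A : set T'), measurable A ->
    distribution P (X i) A = distribution P (X 0%N) A.

(* Mutual independence: the product rule for every finite subfamily. *)
Definition mutually_independent (X : nat -> {RV P >-> T'}) : Prop :=
  forall (s : seq nat) (A : nat -> set T'),
    uniq s -> (forall i, measurable (A i)) ->
    P (\bigcap_(i in [set` s]) (X i @^-1` A i)) =
    (\prod_(i <- s) P (X i @^-1` A i))%E.

End RandomVectors.

Section Regressors.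
Context {d : measure_display} {T : measurableType d}.
Context {R : realType} (P : probability T R) {M : nat}.

Definition component (X : {RV P >-> M.-tuple R}) (j : 'I_M) : T -> R :=
  fun w => tnth (X w) j.

Definition zero_mean (X : {RV P >-> M.-tuple R}) : Prop :=
  forall j, ('E_P[component X j] = 0)%E.

Definition has_covariance (X : {RV P >-> M.-tuple R}) (S : 'M[R]_M) : Prop :=
  forall j k, covariance P (component X j) (component X k) = (S j k)%:E.

(* u_i = [x(i), x(i - 1), ..., x(i - M + 1)]; the scalar input x is indexed by
   [int] so that the first regressors also have M past samples. *)
Definition tap_delay_line (x : int -> {RV P >-> R})
    (u : nat -> {RV P >-> M.-tuple R}) : Prop :=
  forall (i : nat) (j : 'I_M) (w : T),
    tnth (u i w) j = x (i%:Z - (j : nat)%:Z) w.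

Definition input_variance (x : int -> {RV P >-> R}) (s2 : R) : Prop :=
  forall k, ('E_P[fun w => (x k w ^+ 2)%R] = s2%:E)%E.

End Regressors.

Variant node_filter := LMS | NLMS.

(* Overlapping windows of a tap-delay line are not independent when M >= 2,
   unless the input vanishes; independence over time is therefore only required
   of LMS nodes (whose scalar input x and variance s2 play no role). *)
Definition regressor_model (d : measure_display) (T : measurableType d)
    (R : realType) (P : probability T R) (M : nat) (alg : node_filter)
    (u : nat -> {RV P >-> M.-tuple R}) (S : 'M[R]_M)
    (x : int -> {RV P >-> R}) (s2 : R) : Prop :=
  [/\ identically_distributed u,
      (forall i, zero_mean (u i)),
      (forall i, has_covariance (u i) S) &
      match alg with
      | LMS => mutually_independent u
      | NLMS => tap_delay_line x u /\ input_variance x s2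
      end].

Section Network.
Context {R : realType} {N M : nat}.

Definition combiner (link : rel 'I_N) (C : 'M[R]_N) : Prop :=
  [/\ (forall n l, 0 <= C n l),
      (forall n l, ~~ ((l != n) && link l n) -> C n l = 0) &
      (forall n, \sum_(l < N) C n l = 1)].

Definition Rmu (alg : node_filter) (mu : 'I_N -> R) (S : 'I_N -> 'M[R]_M)
    (s2 : 'I_N -> R) : 'M[R]_(N * M) :=
  blockdiag (fun n => match alg with
                      | LMS => mu n *: S n
                      | NLMS => (mu n / (M%:R * s2 n)) *: S n
                      end).

(* Mean of the supervisor variable a_n(i). *)
Definition abar (d : measure_display) (T : measurableType d)
    (P : probability T R) (a : 'I_N -> nat -> {RV P >-> R})
    (n : 'I_N) (i : nat) : R :=
  fine 'E_P[a n i]%E.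

(* Only used for i >= 1. *)
Definition lambdabar (ab : 'I_N -> nat -> R) (n : 'I_N) (i : nat) : R :=
  1 / (1 + expR (- ab n i.-1)).

Definition Lbar (ab : 'I_N -> nat -> R) (i : nat) : 'M[R]_(N * M) :=
  diag_mx (\row_(n < N) lambdabar ab n i) *t (1%:M : 'M[R]_M).

Definition mean_error_mx (C : 'M[R]_N) (L Rm : 'M[R]_(N * M)) :
    'M[R]_(N * M + N * M) :=
  let G := C *t (1%:M : 'M[R]_M) in
  block_mx ((1%:M - L) *m G) L 0 (1%:M - Rm).

Definition converges_exponentially_to_origin (k : nat)
    (X : nat -> 'cV[R]_k) : Prop :=
  X @ \oo --> (0 : 'cV[R]_k) /\
  exists K r : R, [/\ 0 < r, r < 1 & forall i, `|X i| <= K * r ^+ i].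

End Network.

(* Main.v *)
Require Import Defs.
From mathcomp Require Import ring lra.
Set Implicit Arguments.
Unset Strict Implicit.
Unset Printing Implicit Defensive.
Import Order.TTheory GRing.Theory Num.Theory.
Import numFieldNormedType.Exports.
Local Open Scope classical_set_scope.
Local Open Scope ring_scope.

(** Write the error vector as the stack of the supervisor errors [w i] and the
    filter errors [psi i].  The recursion is block triangular, so the filter
    errors evolve alone, by [psi i = A *m psi i.-1] with [A = 1%:M - Rmu].
    Covariance matrices are symmetric, hence so is [A]; it is diagonalizable
    over the complex numbers, and [psi] decays like [r ^+ i] for any
    [r >= 0] at least the spectral radius of [A] ([symmetric_iter_le]).

    The supervisor errors are governed by the maximum norm, which is the norm
    of matrices here.  Truncation of the supervisor variables keeps every
    mixing weight between some [delta > 0] and 1 ([abar_ge],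
    [lambdabar_bounds]), and averaging over neighbours does not increase the
    maximum norm because the rows of the combiner are convex weights
    ([kron_average_le]).  One step thus gives
    [`|w i.+1| <= (1 - delta) * `|w i| + `|psi i|] ([combination_step_le]),
    uniformly in the weights, which may therefore vary arbitrarily with time.
    A contraction driven by a geometrically decaying input decays geometrically
    at any rate [r < 1] that is strictly larger than [1 - delta] and dominates
    the decay of the input ([perturbed_contraction_le]). *)

(** * Maximum norm of matrices *)

Lemma mx_norm_leP (R : realType) m n (A : 'M[R]_(m, n)) (e : R) : 0 <= e ->
  reflect (forall i j, `|A i j| <= e) (`|A| <= e).
Proof.
move=> e0; rewrite [X in X <= e]/Num.Def.normr /= mx_normrE.
apply: (iffP (bigmax_leP _ _ _ _)) => /=.
  by move=> [_ h] i j; exact: (h (i, j)).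
by move=> h; split=> // -[i j] _; exact: h.
Qed.

Lemma le_mx_norm (R : realType) m n (A : 'M[R]_(m, n)) i j :
  `|A i j| <= `|A|.
Proof. by move: i j; apply/mx_norm_leP. Qed.

(** * Decay of iterates of a symmetric matrix *)

Lemma Re_norm_real (R : realType) (z : R[i]) :
  (complex.Re `|z|)%:C%C = `|z|.
Proof. by apply: RRe_real; exact: normr_real. Qed.

(** The supremum defining the spectral radius is over a bounded set: the
    eigenvalues are the finitely many roots of the characteristic polynomial,
    and each is bounded by the sum of all moduli. *)
Lemma eigenvalue_le_spectral_radius (R : realType) n (A : 'M[R]_n) (z : R[i]) :
  eigenvalue (map_mx (real_complex R) A) z ->
  `|z| <= (spectral_radius A)%:C%C.
Proof.
move=> Az; rewrite -Re_norm_real lecR.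
have [s /esym sE] := closed_field_poly_normal (char_poly (map_mx (real_complex R) A)).
rewrite (monicP (char_poly_monic _)) scale1r in sE.
apply: ub_le_sup; last by exists z.
exists (complex.Re (\sum_(x <- s) `|x|)) => _ [x /= Ax <-].
have xs : x \in s.
  by rewrite -root_prod_XsubC sE -eigenvalue_root_char.
suff: `|x| <= \sum_(y <- s) `|y| by rewrite lecE => /andP[].
by rewrite (big_rem x xs) /= lerDl sumr_ge0.
Qed.

(** Symmetry allows equality between [r] and the spectral radius: there are no
    Jordan blocks, and in the eigenbasis given by the rows of [P] each
    coordinate of [v i] is multiplied at each step by its eigenvalue. *)
Lemma symmetric_iter_le (R : realType) n (A : 'M[R]_n) (r : R)
    (v : nat -> 'cV[R]_n) :
  A^T = A -> spectral_radius A <= r -> 0 <= r ->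
  (forall i, v i.+1 = A *m v i) ->
  exists K : R, 0 <= K /\ forall i, `|v i| <= K * r ^+ i.
Proof.
move=> Asym Ar r0 vS.
pose AC := map_mx (real_complex R) A.
have ACn : AC \is normalmx.
  apply: symmetric_normalmx.
    apply/is_hermitianmxP; rewrite expr0 scale1r map_mx_id//.
    by rewrite map_trmx Asym.
  by apply/mxOverP => i j; rewrite mxE complex_real.
pose P := spectralmx AC; pose D := spectral_diag AC.
have PU : P \in unitmx := spectral_unit AC.
have AE : AC = invmx P *m diag_mx D *m P by apply/orthomx_spectralP.
have DA k : `|D 0 k| <= r%:C%C.
  apply: le_trans (_ : (spectral_radius A)%:C%C <= _); last by rewrite lecR.
  apply: eigenvalue_le_spectral_radius; apply/eigenvalueP.
  (* the rows of P are row eigenvectors of AC, as P *m AC = diag_mx D *m P *)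
  exists (row k P).
    by rewrite -/AC AE !mulmxA -row_mul mulmxV// row1 -rowE row_diag_mx
      -scalemxAl -rowE.
  apply/eqP => Pk0; have := congr1 (mulmx^~ (invmx P)) Pk0.
  rewrite -row_mul mulmxV// mul0mx => /rowP/(_ k)/eqP.
  by rewrite !mxE eqxx oner_eq0.
(* y i: the coordinates of v i in the eigenbasis *)
pose y i := P *m map_mx (real_complex R) (v i).
have yS i : y i = \matrix_(k, l) (D 0 k ^+ i * y 0%N k l).
  elim: i => [|i IH]; first by apply/matrixP => k l; rewrite [RHS]mxE mul1r.
  rewrite /y vS map_mxM -/AC AE !mulmxA mulmxV// mul1mx -mulmxA -/(y i) IH.
  by apply/matrixP => k l; rewrite mul_diag_mx !mxE exprS mulrA.
have vE i : map_mx (real_complex R) (v i) = invmx P *m y i.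
  by rewrite /y mulKmx.
(* KC bounds each entry of invmx P *m y i uniformly, up to the factor r ^+ i *)
pose KC : R[i] := \sum_j \sum_k `|invmx P j k| * `|y 0%N k 0|.
have KC0 : 0 <= KC by do 2! apply: sumr_ge0 => ? _; rewrite mulr_ge0.
have KCE : KC = (complex.Re KC)%:C%C by rewrite RRe_real// ger0_real.
exists (complex.Re KC).
have K0 : 0 <= complex.Re KC by rewrite -lecR -KCE.
split=> // i; apply/mx_norm_leP => [|j l]; first by rewrite mulr_ge0 ?exprn_ge0.
rewrite -lecR rmorphM /= -KCE rmorphXn /= ord1.
have -> : `|v i j 0|%:C%C = `|(v i j 0)%:C%C| :> R[i].
  by rewrite normc_def /= expr0n addr0 sqrtr_sqr.
have -> : (v i j 0)%:C%C = (invmx P *m y i) j 0 by rewrite -vE mxE.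
rewrite mxE; apply: le_trans (ler_norm_sum _ _ _) _.
apply: le_trans (_ : (\sum_k `|invmx P j k| * `|y 0%N k 0|) * r%:C%C ^+ i <= _).
  rewrite mulr_suml; apply: ler_sum => k _.
  rewrite yS mxE !normrM -mulrA ler_wpM2l// mulrC ler_wpM2l// normrX.
  by rewrite lerXn2r// nnegrE lecR.
rewrite ler_wpM2r ?exprn_ge0 ?lecR//.
rewrite /KC [leRHS](bigD1 j)//= lerDl sumr_ge0// => ? _.
by rewrite sumr_ge0// => ? _; rewrite mulr_ge0.
Qed.

(** * Symmetry of the mean filter matrix *)

Lemma Rmu_sym (R : realType) N M (alg : node_filter) (mu : 'I_N -> R)
    (S : 'I_N -> 'M[R]_M) (s2 : 'I_N -> R) :
  (forall n, (S n)^T = S n) -> (Rmu alg mu S s2)^T = Rmu alg mu S s2.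
Proof.
move=> Ssym; rewrite /Rmu /blockdiag linear_sum; apply: eq_bigr => n _ /=.
by rewrite trmx_tens trmx_delta; congr (_ *t _); case: alg; rewrite linearZ /= Ssym.
Qed.

Lemma has_covariance_sym (d : measure_display) (T : measurableType d)
    (R : realType) (P : probability T R) M (X : {RV P >-> M.-tuple R})
    (S : 'M[R]_M) : has_covariance X S -> S^T = S.
Proof.
move=> XS; apply/matrixP => j k; rewrite mxE.
by apply: EFin_inj; rewrite -!XS covarianceC.
Qed.

(** * Bounds on the mixing weights *)

Lemma abar_ge (d : measure_display) (T : measurableType d) (R : realType)
    (P : probability T R) N (a : 'I_N -> nat -> {RV P >-> R}) (b : R) n i :
  (forall w, - b <= a n i w <= b) -> - b <= abar a n i.
Proof.
move=> ab; have mA := @measurable_funPT _ _ _ _ (a n i).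
have ai : P.-integrable setT (EFin \o a n i).
  apply: measurable_bounded_integrable => //.
    by apply: fin_num_fun_lty; exact: fin_num_measure.
  exists b; split; first exact: num_real.
  by move=> c bc w _; rewrite /= (le_trans _ (ltW bc))// ler_norml.
rewrite /abar unlock -lee_fin fineK; last exact: integrable_fin_num.
rewrite -[X in (X <= _)%E]mule1 -(probability_setT P) -integral_cst//.
apply: le_integral => //.
  exact: finite_measure_integrable_cst.
by move=> w _; rewrite lee_fin; case/andP: (ab w).
Qed.

Lemma lambdabar_bounds (R : realType) N (ab : 'I_N -> nat -> R) (b : R) n i :
  (forall m, - b <= ab n m) ->
  (1 + expR b)^-1 <= lambdabar ab n i <= 1.
Proof.
move=> abb; rewrite /lambdabar div1r.
have e0 c : 0 < 1 + expR c :> R by rewrite addr_gt0 ?expR_gt0.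
rewrite lef_pV2 ?posrE// lerD2l ler_expR lerNl abb /=.
by rewrite invf_le1// lerDl expR_ge0.
Qed.

(** * One step of the supervisors *)

Lemma LbarE (R : realType) N M (ab : 'I_N -> nat -> R) i :
  Lbar ab i = diag_mx (\row_k lambdabar ab (mxtens_unindex k).1 i) :> 'M[R]_(N * M).
Proof.
apply/matrixP => k l; case: (mxtens_indexP k) => n j; case: (mxtens_indexP l) => p q.
rewrite /Lbar tensmxE !mxE mxtens_indexK /= mulrnAl -mulrnAr.
rewrite (can_eq (@mxtens_indexK _ _)) xpair_eqE.
by case: eqP; case: eqP; rewrite ?(mulr1n,mulr0n,mulr1,mulr0).
Qed.

(** A row-stochastic matrix, acting blockwise, does not increase the maximum
    norm. *)
Lemma kron_average_le (R : realType) N M (C : 'M[R]_N) (W : 'cV[R]_(N * M)) :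
  (forall n l, 0 <= C n l) -> (forall n, \sum_l C n l = 1) ->
  `|(C *t (1%:M : 'M[R]_M)) *m W| <= `|W|.
Proof.
move=> C0 C1; apply/mx_norm_leP => // k l; rewrite mxE.
apply: le_trans (ler_norm_sum _ _ _) _.
have -> : `|W| = \sum_(p < N * M) (C *t (1%:M : 'M[R]_M)) k p * `|W|.
  rewrite -mulr_suml (eq_bigr _ (fun p _ => mxE _ _ _ _)).
  (* the row sum of a Kronecker product is the product of the row sums *)
  rewrite -(mulr_sum (fun p => C _ p) (fun q => (1%:M : 'M[R]_M) _ q)) C1.
  rewrite (bigD1 (mxtens_unindex k).2)//= big1 => [|q qk].
    by rewrite mxE eqxx addr0 !mul1r.
  by rewrite mxE eq_sym (negbTE qk).
apply: ler_sum => p _; rewrite normrM.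
rewrite ger0_norm ?ler_wpM2l ?le_mx_norm//.
all: by rewrite !mxE mulr_ge0.
Qed.

(** [W] is the previous supervisor error, [V] the previous filter error: each
    entry of the result combines an entry of the averaged [W], weighted by at
    most [1 - delta], with an entry of [V], weighted by at most 1. *)
Lemma combination_step_le (R : realType) N M (C : 'M[R]_N)
    (ab : 'I_N -> nat -> R) (delta : R) i (W V : 'cV[R]_(N * M)) :
  (forall n l, 0 <= C n l) -> (forall n, \sum_l C n l = 1) ->
  (forall n, delta <= lambdabar ab n i <= 1) -> 0 <= delta <= 1 ->
  `|((1%:M - Lbar ab i) *m (C *t (1%:M : 'M[R]_M))) *m W + Lbar ab i *m V|
    <= (1 - delta) * `|W| + `|V|.
Proof.
move=> C0 C1 lb /andP[d0 d1]; rewrite -mulmxA.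
have GW := kron_average_le W C0 C1.
set U := (C *t _) *m W in GW *.
apply/mx_norm_leP => [|k l]; first by rewrite addr_ge0 ?mulr_ge0 ?subr_ge0.
rewrite mulmxBl mul1mx LbarE !mul_diag_mx.
have := lb (mxtens_unindex k).1.
set z := lambdabar _ _ _ => /andP[dz z1]; have z0 := le_trans d0 dz.
set E := (X in `|X|); have {E}-> : E = (1 - z) * U k l + z * V k l.
  by rewrite /E !mxE mulrBl mul1r.
rewrite (le_trans (ler_normD _ _))// (normrM (1 - z)) (normrM z).
rewrite (ger0_norm z0) ger0_norm ?subr_ge0// lerD//.
  rewrite ler_pM ?subr_ge0// ?lerB//.
  exact: le_trans (le_mx_norm _ _ _) GW.
by rewrite -[leRHS]mul1r ler_pM// le_mx_norm.
Qed.

(** * Geometric decay *)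

(** The constant [B = K / (r - q)] is the one for which [B * r ^+ i] solves the
    recursion [x i.+1 = q * x i + K * r ^+ i]. *)
Lemma perturbed_contraction_le (R : realType) (w : nat -> R) (q K r : R) :
  0 <= q -> q < r -> 0 <= K ->
  (forall i, 0 <= w i) ->
  (forall i, w i.+1 <= q * w i + K * r ^+ i) ->
  forall i, w i <= (w 0%N + K / (r - q)) * r ^+ i.
Proof.
move=> q0 qr K0 w0 wS; have rq : 0 < r - q by rewrite subr_gt0.
have r0 : 0 < r := le_lt_trans q0 qr.
elim=> [|i IH]; first by rewrite mulr1 lerDl divr_ge0// ltW.
apply: le_trans (wS i) _.
apply: le_trans (lerD (ler_wpM2l q0 IH) (lexx _)) _.
rewrite mulrA -mulrDl exprS mulrA ler_wpM2r ?exprn_ge0 ?(ltW r0)//.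
set B := K / _; have -> : K = B * (r - q) by rewrite /B divfK// gt_eqF.
rewrite -subr_ge0 (_ : _ - _ = w 0%N * (r - q)); last by ring.
by rewrite mulr_ge0// ltW.
Qed.

Lemma exponential_bound_converges (R : realType) k (X : nat -> 'cV[R]_k)
    (K r : R) : 0 < r -> r < 1 -> (forall i, `|X i| <= K * r ^+ i) ->
  converges_exponentially_to_origin X.
Proof.
move=> r0 r1 XK; split; last by exists K, r.
apply/norm_cvg0P.
apply: (squeeze_cvgr (f := fun=> 0) (h := fun i => K * r ^+ i)).
- by apply: nearW => i; rewrite normr_ge0 XK.
- exact: cvg_cst.
- rewrite -[X in _ --> X](mulr0 K); apply: cvgMr.
  by apply: cvg_expr; rewrite ger0_norm// ltW.
Qed.

Theorem mainTheorem3 (R : realType) (d : measure_display)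
    (T : measurableType d) (P : probability T R) (N M : nat)
    (* node filters: common algorithm, step-sizes, regressors, covariances,
       scalar inputs and their variances *)
    (alg : node_filter) (mu : 'I_N -> R)
    (u : 'I_N -> nat -> {RV P >-> M.-tuple R}) (Rcov : 'I_N -> 'M[R]_M)
    (x : 'I_N -> int -> {RV P >-> R}) (sigma2 : 'I_N -> R)
    (hreg : forall n, regressor_model alg (u n) (Rcov n) (x n) (sigma2 n))
    (* combiner matrix *)
    (link : rel 'I_N) (C : 'M[R]_N) (hC : combiner link C)
    (* supervisor variables, truncated to [-a_+, a_+] *)
    (aplus : R) (haplus : 0 < aplus) (a : 'I_N -> nat -> {RV P >-> R})
    (ha : forall n i w, - aplus <= a n i w <= aplus)
    (* all node filters are stable in the mean *)
    (hstable : spectral_radius (1%:M - Rmu alg mu Rcov sigma2) < 1)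
    (* mean-error model *)
    (Theta : nat -> 'cV[R]_(N * M + N * M))
    (hTheta : forall i : nat, (0 < i)%N ->
       Theta i = mean_error_mx C (Lbar (abar a) i) (Rmu alg mu Rcov sigma2)
                   *m Theta i.-1) :
  converges_exponentially_to_origin Theta.
Proof.
set A := 1%:M - _ in hstable.
have Asym : A^T = A.
  rewrite linearB /= trmx1 Rmu_sym// => n.
  by have [_ _ /(_ 0%N)/has_covariance_sym] := hreg n.
have [C0 _ C1] := hC.
pose delta := (1 + expR aplus)^-1.
have e0 := expR_gt0 aplus.
have d0 : 0 < delta by rewrite invr_gt0 addr_gt0.
have d1 : delta < 1 by rewrite invf_lt1 ?addr_gt0// ltrDl.
have lb n i : delta <= lambdabar (abar a) n i <= 1.
  by apply: lambdabar_bounds => m; apply: abar_ge => w; exact: ha.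
pose w i := usubmx (Theta i); pose psi i := dsubmx (Theta i).
have [wS psiS] : (forall i, w i.+1 =
      (1%:M - Lbar (abar a) i.+1) *m (C *t 1%:M) *m w i
      + Lbar (abar a) i.+1 *m psi i) /\ (forall i, psi i.+1 = A *m psi i).
  suff h i : Theta i.+1 =
      col_mx ((1%:M - Lbar (abar a) i.+1) *m (C *t 1%:M) *m w i
        + Lbar (abar a) i.+1 *m psi i) (A *m psi i).
    by split=> i; rewrite /w /psi h ?col_mxKu ?col_mxKd.
  rewrite hTheta//= -(vsubmxK (Theta i)) /mean_error_mx mul_block_col mul0mx add0r.
  by [].
(* r is a common rate: the midpoint of 1 and the larger contraction factor q *)
pose q := Num.max (1 - delta) (spectral_radius A).
have q1 : q < 1 by rewrite gt_max hstable andbT ltrBlDr ltrDl.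
have q0 : 0 < q by rewrite lt_max subr_gt0 d1.
pose r := (q + 1) / 2.
have qr : q < r by rewrite /r; lra.
have r1 : r < 1 by rewrite /r; lra.
have [K [K0 psiK]] : exists K, 0 <= K /\ forall i, `|psi i| <= K * r ^+ i.
  apply: symmetric_iter_le Asym _ _ psiS; last by rewrite (le_trans (ltW q0)) ?ltW.
  by apply: le_trans (ltW qr); rewrite le_max lexx orbT.
have wK i : `|w i| <= (`|w 0%N| + K / (r - (1 - delta))) * r ^+ i.
  apply: (@perturbed_contraction_le _ (fun m => `|w m|)) => //.
  - by rewrite subr_ge0 ltW.
  - by apply: le_lt_trans qr; rewrite le_max lexx.
  - move=> m; rewrite wS; apply: le_trans (combination_step_le _ _ C0 C1 _ _) _.
    + by move=> n; exact: lb.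
    + by rewrite !ltW.
    + by rewrite lerD2l psiK.
apply: (@exponential_bound_converges _ _ _ (Num.max (`|w 0%N| + K / (r - (1 - delta))) K) r).
- exact: lt_trans q0 qr.
- exact: r1.
move=> i.
have rn : 0 <= r ^+ i by rewrite exprn_ge0// ltW// (lt_trans q0 qr).
apply/mx_norm_leP => [|k l].
  by rewrite mulr_ge0// le_max K0 orbT.
rewrite -(vsubmxK (Theta i)) mxE; case: splitP => j _.
  apply: le_trans (le_mx_norm _ _ _) _; apply: le_trans (wK i) _.
  by rewrite ler_wpM2r// le_max lexx.
apply: le_trans (le_mx_norm _ _ _) _; apply: le_trans (psiK i) _.
by rewrite ler_wpM2r// le_max lexx orbT.
Qed.
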